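(* Let $n\ge 2$ and $\Re\in\{\mathbb{Q},\mathbb{R},\mathbb{C}\}$. Then: 1) The $\Re$-vector space $K(M_n)$ is spanned by $\{l_w, r_w \mid w\in M_n\}$. 2) The $\Re$-vector space $K(F_n)$ is spanned by $\{l_w, r_w \mid w\in F_n\}$. 3) The $\Re$-vector space $K_{Br}(F_n)$ is spanned by $\{s_w, se_w \mid w\in F_n\}$.
   Context: Words. Let $S=\{a_1,\dots,a_n\}$ be a finite set of letters, $n\ge 2$. $M_n$ is the free monoid: the set of all finite words over $S$, including the empty word $\epsilon$. Let $\bar S=\{a_i,a_i^{-1}\mid 1\le i\le n\}$, with $(a_i^{-1})^{-1}=a_i$. $F_n$ is the free group, viewed as the set of all reduced words over $\bar S$ (words with no subword $a_ia_i^{-1}$ or $a_i^{-1}a_i$), including $\epsilon$. $|w|$ is the length of $w$, $w_i$ its $i$-th letter, and $w_{fin}=w_{|w|}$ its last letter. The inverse of a reduced word is $w^{-1}=w_{fin}^{-1}\cdots w_1^{-1}$. Counting functions. For words $v,w$ in $M_n$ (resp. reduced words $v,w$ in $F_n$) with $v\ne\epsilon$, $p_v(w)$ is the number of indices $i$ with $v=w_iw_{i+1}\cdots w_{i+|v|-1}$ (occurrences of $v$ as a contiguous subword, overlaps allowed); $p_\epsilon(w)=|w|$. The functions $p_v$ are called elementary counting functions. $C(M_n)$ (resp. $C(F_n)$) is the $\Re$-vector space of all finite $\Re$-linear combinations of the functions $p_v$, regarded as functions $M_n\to\Re$ (resp. $F_n\to\Re$). Equivalence and kernels. Two functions are equivalent,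 $f_1\sim f_2$, if $\|f_1-f_2\|_\infty<\infty$. $K(M_n)$ (resp. $K(F_n)$) is the subspace of all $f\in C(M_n)$ (resp. $f\in C(F_n)$) with $f\sim 0$, i.e. the bounded counting functions. Brooks space. For $w\in F_n$ with $|w|\ge1$ the Brooks quasimorphism is $\phi_w=p_w-p_{w^{-1}}$; also $\phi_\epsilon=0$. $Br(F_n)$ is the $\Re$-linear span of the $\phi_w$, and $\widehat{Br}(F_n)$ is the quotient of $Br(F_n)$ by the subspace of bounded functions; $\widehat{\phi}$ denotes the class of $\phi$. The linear map $\sigma: C(F_n)\to\widehat{Br}(F_n)$ is given by $\sigma(p_w)=\widehat{\phi_w}$, and $K_{Br}(F_n)=\ker\sigma$. Relations. For $w\in M_n$: $l_w=p_w-\sum_{s\in S}p_{sw}$ and $r_w=p_w-\sum_{s\in S}p_{ws}$. For $w\in F_n$: $l_w=p_w-\sum_{s\in\bar S\setminus\{w_1^{-1}\}}p_{sw}$ and $r_w=p_w-\sum_{s\in\bar S\setminus\{w_{fin}^{-1}\}}p_{ws}$ (for $w=\epsilon$ the sums run over all of $\bar S$). For $w\in F_n$: $s_w=p_w+p_{w^{-1}}$ and $se_w=l_w-r_{w^{-1}}$, where $l_w$ and $r_{w^{-1}}$ are the free group extension relations. *)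

(* Defs.v *)
From HB Require Import structures.
From mathcomp Require Import all_boot all_order all_algebra.
From mathcomp Require Import ring_quotient complex.
From mathcomp Require Import boolp classical_sets functions reals.
Set Implicit Arguments.
Unset Strict Implicit.
Unset Printing Implicit Defensive.
Import Order.TTheory GRing.Theory Num.Theory.
Local Open Scope classical_set_scope.
Local Open Scope ring_scope.
Local Open Scope quotient_scope.

Variant scalar_kind := Rationals | Reals | Complexes.

Definition scalars (R : realType) (k : scalar_kind) : numFieldType :=
  match k with
  | Rationals => rat
  | Reals => R
  | Complexes => R[i]
  end.

Section LinearSpan.
Variables (K : fieldType) (V : lmodType K).

Definition lspan (G : set V) : set V :=
  [set v | exists (m : nat) (c : 'I_m -> K) (g : 'I_m -> V),
     (forall i, G (g i)) /\ v = \sum_(i < m) c i *: g i].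

Definition lspan_pred (G : set V) : pred V := fun v => `[< lspan G v >].

Lemma lspan_submod_closed G : submod_closed (lspan_pred G).
Proof.
split; first by apply/asboolP; exists 0%N, (fun=> 0), (fun=> 0); split;
  [case | rewrite big_ord0].
move=> a u v /asboolP[m [c [g [Gg ->]]]] /asboolP[m' [c' [g' [Gg' ->]]]].
apply/asboolP; exists (m + m')%N.
exists (fun i =>
  match fintype.split i with inl j => a * c j | inr j => c' j end).
exists (fun i => match fintype.split i with inl j => g j | inr j => g' j end).
split=> [i|]; first by case: (fintype.split i).
rewrite big_split_ord/= scaler_sumr; congr (_ + _); apply: eq_bigr => i _.
  by rewrite (unsplitK (inl i)) scalerA.
by rewrite (unsplitK (inr i)).
Qed.

HB.instance Definition _ (G : set V) :=
  GRing.isSubmodClosed.Build K V (lspan_pred G) (lspan_submod_closed G).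

Lemma lspan_incl (G : set V) v : G v -> lspan G v.
Proof.
by move=> Gv; exists 1%N, (fun=> 1), (fun=> v); rewrite big_ord1 scale1r.
Qed.

Record lspan_type (G : set V) :=
  LSpan { lspan_val : V; _ : lspan_val \in lspan_pred G }.

HB.instance Definition _ G := [isSub for @lspan_val G].
HB.instance Definition _ G := [Choice of lspan_type G by <:].
HB.instance Definition _ G := [SubChoice_isSubLmodule of lspan_type G by <:].

Definition lspan_elt (G : set V) v (Gv : G v) : lspan_type G :=
  LSpan (asboolT (lspan_incl Gv)).

End LinearSpan.

(* The quotient V / U of a vector space by a subspace: the quotient group
   Quotient.quot of the library, with the induced scaling. *)
Section LinearQuotient.
Variables (K : fieldType) (V : lmodType K) (U : {pred V}).
Hypothesis submodU : submod_closed U.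

Definition lquot_kernel : zmodClosed V :=
  HB.pack U (GRing.isZmodClosed.Build V U (GRing.submod_closedB submodU)).

Definition lquot := Quotient.quot lquot_kernel.
HB.instance Definition _ := Choice.on lquot.
HB.instance Definition _ := GRing.Zmodule.on lquot.

Definition lquot_class (v : V) : lquot := \pi_((Quotient.quot lquot_kernel)) v.

Lemma lquot_class_eq u v : (lquot_class u = lquot_class v) <-> (u - v \in U).
Proof.
rewrite -[u - v \in U]/(u - v \in lquot_kernel) Quotient.idealrBE.
by split => /eqP.
Qed.

Lemma lquot_class_surj (x : lquot) : lquot_class (repr x) = x.
Proof. exact: reprK. Qed.

Lemma lquot_classD u v : lquot_class (u + v) = lquot_class u + lquot_class v.
Proof. by rewrite /lquot_class !piE. Qed.

Definition lquot_scale (a : K) (x : lquot) : lquot :=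
  lquot_class (a *: repr (x : (Quotient.quot lquot_kernel))).

Lemma lquot_classZ a u : lquot_class (a *: u) = lquot_scale a (lquot_class u).
Proof.
apply/lquot_class_eq; have [U0 UZD] := submodU.
rewrite -scalerBr -[_ *: _]addr0; apply: UZD => //.
by apply/lquot_class_eq; rewrite lquot_class_surj.
Qed.

Lemma lquot_scaleA a b x :
  lquot_scale a (lquot_scale b x) = lquot_scale (a * b) x.
Proof. by rewrite -(lquot_class_surj x) -!lquot_classZ scalerA. Qed.

Lemma lquot_scale1 : left_id 1 lquot_scale.
Proof. by move=> x; rewrite -(lquot_class_surj x) -!lquot_classZ scale1r. Qed.

Lemma lquot_scaleDr : right_distributive lquot_scale +%R.
Proof.
move=> a x y; rewrite -(lquot_class_surj x) -(lquot_class_surj y).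
by rewrite -!lquot_classZ -!lquot_classD -lquot_classZ scalerDr.
Qed.

Lemma lquot_scaleDl x : {morph lquot_scale^~ x : a b / a + b}.
Proof.
move=> a b; rewrite -(lquot_class_surj x).
by rewrite -!lquot_classZ -!lquot_classD scalerDl.
Qed.

HB.instance Definition _ := GRing.Zmodule_isLmodule.Build K lquot
  lquot_scaleA lquot_scale1 lquot_scaleDr lquot_scaleDl.

Lemma lquot_class_linear : linear lquot_class.
Proof. by move=> a u v; rewrite lquot_classD lquot_classZ. Qed.

HB.instance Definition _ :=
  GRing.isLinear.Build K V lquot *:%R lquot_class lquot_class_linear.

End LinearQuotient.

Definition fequiv (K : numFieldType) (X : Type) (f g : X -> K) : Prop :=
  exists M : K, forall x, `|f x - g x| <= M.

(* The number of occurrences of v in w; for v = [::] every index i < size w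
   counts, which is the convention p_epsilon(w) = |w|. *)
Definition occ (T : eqType) (v w : seq T) : nat :=
  #|[pred i : 'I_(size w) | prefix v (drop i w)]|.

Lemma occ_nil (T : eqType) (w : seq T) : occ [::] w = size w.
Proof.
by rewrite -[RHS]card_ord; apply: eq_card => i; rewrite !inE prefix0s.
Qed.

Section FreeMonoid.
Variables (K : numFieldType) (n : nat).
Local Notation word := (seq 'I_n).
Implicit Types w : word.

Definition pM (v : word) : word -> K^o := fun w => (occ v w)%:R.

Definition CM : set (word -> K^o) := lspan (range pM).

Definition KM : set (word -> K^o) := [set f | CM f /\ fequiv f 0].

Definition lM w : word -> K^o := pM w - \sum_(s : 'I_n) pM (s :: w).

Definition rM w : word -> K^o := pM w - \sum_(s : 'I_n) pM (rcons w s).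

End FreeMonoid.

Arguments pM K {n} v _.
Arguments CM K n _ : clear implicits.
Arguments KM K n _ : clear implicits.
Arguments lM K {n} w _.
Arguments rM K {n} w _.

(* The letter a_i is (i, true), its inverse is (i, false). *)
Definition letter (n : nat) : Type := ('I_n * bool)%type.
HB.instance Definition _ n := Finite.on (letter n).

Definition linv n (x : letter n) : letter n := (x.1, ~~ x.2).

Definition reduced n (w : seq (letter n)) : bool :=
  sorted (fun x y => y != linv x) w.

Definition winv n (w : seq (letter n)) : seq (letter n) :=
  rev (map (@linv n) w).

Record Fn (n : nat) :=
  ReducedWord { fword :> seq (letter n); fword_reduced : reduced fword }.

HB.instance Definition _ n := [isSub for @fword n].
HB.instance Definition _ n := [Countable of Fn n by <:].

Lemma linvK n : involutive (@linv n).
Proof. by case=> i b; rewrite /linv/= negbK. Qed.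

Lemma winvK n : involutive (@winv n).
Proof.
move=> w; rewrite /winv map_rev revK -map_comp -[RHS]map_id.
by apply: eq_map => x /=; rewrite linvK.
Qed.

Lemma size_winv n (w : seq (letter n)) : size (winv w) = size w.
Proof. by rewrite size_rev size_map. Qed.

Lemma reduced_winv n (w : seq (letter n)) : reduced w -> reduced (winv w).
Proof.
rewrite /reduced /winv rev_sorted sorted_map; apply: sub_sorted => x y /=.
by apply: contra => /eqP /(can_inj (@linvK n)) ->; rewrite linvK.
Qed.

Definition finv_word n (w : Fn n) : Fn n :=
  ReducedWord (reduced_winv (fword_reduced w)).

Lemma occ_winv n (v w : seq (letter n)) : occ (winv v) (winv w) = occ v w.
Proof.
have [->|v0] := eqVneq v [::]; first by rewrite /= !occ_nil size_winv.
have le_occ (u x : seq (letter n)) :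
    u != [::] -> (occ u x <= occ (winv u) (winv x))%N.
  rewrite -size_eq0 -lt0n => u0.
  have fP (i : 'I_(size x)) : (size x - size u - i < size (winv x))%N.
    rewrite size_winv (leq_ltn_trans (leq_subr _ _))// ltn_subrL u0.
    exact: leq_ltn_trans (ltn_ord i).
  pose f i := Ordinal (fP i).
  have eq_x (i : 'I_(size x)) : prefix u (drop i x) ->
      exists2 t, x = take i x ++ u ++ t & (size t = size x - size u - i)%N.
    move=> /prefixP[t xE]; exists t; first by rewrite -xE cat_take_drop.
    by rewrite subnAC -size_drop xE size_cat addKn.
  rewrite /occ -(@card_in_imset _ _ f).
    apply/subset_leq_card/fintype.subsetP => j /imsetP[k].
    rewrite !inE => /eq_x[t xE tE] ->; rewrite /= -tE.
    have -> : winv x = winv t ++ winv u ++ winv (take k x).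
      by rewrite [in LHS]xE /winv !map_cat !rev_cat catA.
    by rewrite drop_size_cat ?size_winv// prefix_prefix.
  move=> i j; rewrite !inE => /eq_x[t xE tE] /eq_x[t' xE' tE'].
  move=> /(congr1 val)/=; rewrite -tE -tE' => tt; apply/val_inj => /=.
  have := congr1 size xE; rewrite {1}xE' !size_cat -tt => /eqP.
  by rewrite eqn_add2r !size_take !ltn_ord => /eqP.
apply/eqP; rewrite eqn_leq le_occ// andbT.
rewrite -{2}(winvK v) -{2}(winvK w) le_occ//.
by rewrite -size_eq0 size_winv size_eq0.
Qed.

Section FreeGroup.
Variables (K : numFieldType) (n : nat).
Implicit Types v w : seq (letter n).

(* Indexed by raw words for convenience; below v is always reduced. *)
Definition pF v : Fn n -> K^o := fun x => (occ v x)%:R.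

Definition elementary : set (Fn n -> K^o) := range (fun v : Fn n => pF v).

Definition CF : set (Fn n -> K^o) := lspan elementary.

Definition KF : set (Fn n -> K^o) := [set f | CF f /\ fequiv f 0].

Definition lF w : Fn n -> K^o :=
  pF w - \sum_(s : letter n | if w is x :: _ then s != linv x else true)
           pF (s :: w).

Definition rF w : Fn n -> K^o :=
  pF w - \sum_(s : letter n |
               if w is x :: w' then s != linv (last x w') else true)
           pF (rcons w s).

(* For w = epsilon this is p_epsilon - p_epsilon = 0, as required. *)
Definition phi w : Fn n -> K^o := pF w - pF (winv w).

Definition brooks : set (Fn n -> K^o) := range (fun v : Fn n => phi v).

Definition CF_space := lspan_type elementary.
HB.instance Definition _ := GRing.Lmodule.on CF_space.

Definition Br_space := lspan_type brooks.
HB.instance Definition _ := GRing.Lmodule.on Br_space.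

Definition Br_bounded : pred Br_space := fun f => `[< fequiv (val f) 0 >].

Lemma Br_bounded_submod_closed : submod_closed Br_bounded.
Proof.
split; first by apply/asboolP; exists 0 => x; rewrite subrr normr0.
move=> a f g /asboolP[A fA] /asboolP[B gB]; apply/asboolP.
exists (`|a| * A + B) => x; rewrite subr0.
have := fA x; have := gB x; rewrite !subr0 => gx fx.
rewrite (le_trans (ler_normD _ _))// lerD// normrM ler_wpM2l//.
Qed.

Definition Br_hat := lquot Br_bounded_submod_closed.
HB.instance Definition _ := GRing.Lmodule.on Br_hat.

Definition p_elt (v : Fn n) : CF_space :=
  lspan_elt (imageT (fun v : Fn n => pF v) v).

Definition phi_hat (v : Fn n) : Br_hat :=
  lquot_class Br_bounded_submod_closed
    (lspan_elt (imageT (fun v : Fn n => phi v) v)).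

(* Since p_(v^-1)(x) = p_v(x^-1), the map taking f to f(x) - f(x^-1) is linear
   and sends p_v to phi_v; this shows that sigma is well defined. *)
Lemma pF_winv v (x : Fn n) : pF (winv v) x = pF v (finv_word x).
Proof. by rewrite /pF/= -{1}(winvK x) occ_winv. Qed.

Definition antisym (f : Fn n -> K^o) : Fn n -> K^o :=
  fun x => f x - f (finv_word x).

Lemma antisym_brooks (f : CF_space) : antisym (val f) \in lspan_pred brooks.
Proof.
case: f => f /= /asboolP[m [c [g [Gg ->]]]]; apply/asboolP.
exists m, c, (antisym \o g); split=> [i|].
  rewrite /=; have [v _ <-] := Gg i; exists v => //.
  by apply/funext => x; rewrite /phi /antisym/= -pF_winv.
apply/funext => x; rewrite /antisym !fct_sumE -sumrB.
by apply: eq_bigr => i _; rewrite /= /antisym scalerBr.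
Qed.

Definition antisym_elt (f : CF_space) : Br_space := LSpan (antisym_brooks f).

Definition antisym_hat (f : CF_space) : Br_hat :=
  lquot_class Br_bounded_submod_closed (antisym_elt f).

Lemma antisym_hat_linear : linear antisym_hat.
Proof.
move=> a f g; rewrite /antisym_hat -linearP; congr lquot_class.
apply/val_inj/funext => x /=.
rewrite /antisym/= !(addrfctE, scalrfctE) /antisym.
by rewrite scalerBr opprD addrACA.
Qed.

HB.instance Definition _ :=
  GRing.isLinear.Build K CF_space Br_hat *:%R antisym_hat antisym_hat_linear.

Lemma sigma_exists : exists sigma : {linear CF_space -> Br_hat},
  forall v : Fn n, sigma (p_elt v) = phi_hat v.
Proof.
exists antisym_hat => v; congr lquot_class; apply/val_inj/funext => x.
by rewrite /= /antisym/phi/= -pF_winv.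
Qed.

(* The linear map with sigma (p_v) = phi_hat v; it is unique since the p_v span
   CF_space. *)
Definition sigma : {linear CF_space -> Br_hat} := sval (cid sigma_exists).

Lemma sigma_p (v : Fn n) : sigma (p_elt v) = phi_hat v.
Proof. exact: (svalP (cid sigma_exists)). Qed.

Definition KBr : set (Fn n -> K^o) :=
  [set val f | f in [set f : CF_space | sigma f = 0]].

Definition sF w : Fn n -> K^o := pF w + pF (winv w).

Definition seF w : Fn n -> K^o := lF w - rF (winv w).

End FreeGroup.

Arguments pF K {n} v _.
Arguments phi K {n} w _.
Arguments CF K n _ : clear implicits.
Arguments KF K n _ : clear implicits.
Arguments KBr K n _ : clear implicits.
Arguments lF K {n} w _.
Arguments rF K {n} w _.
Arguments sF K {n} w _.
Arguments seF K {n} w _.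

(* Main.v *)
Require Import Defs.
From mathcomp Require Import all_boot all_order all_algebra.
From mathcomp Require Import boolp classical_sets functions reals.
From mathcomp Require Import complex archimedean ring.
Set Implicit Arguments.
Unset Strict Implicit.
Unset Printing Implicit Defensive.
Import Order.TTheory GRing.Theory Num.Theory.
Local Open Scope classical_set_scope.
Local Open Scope ring_scope.

(** All three parts come from one fact about a finite alphabet A with a relation
    e of allowed successions, such that any two letters x and y admit z with
    e x z and e z y. The admissible words are all words for the free monoid, and
    the reduced words for the free group. A word v that is not admissible never
    occurs, so p_v = 0, and the extension relations can be summed over all
    letters. The fact is that the bounded counting functions are spanned by the
    l_v and r_v (bounded_counting).

    The relations are bounded: l_v and r_v only see whether v is a prefix,
    respectively a suffix (lrelE, rrelE). Conversely, let f be a bounded counting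
    function. Modulo the r_v, a counting function of v is a sum of counting
    functions of longer words, so f may be taken to be a sum of c_v p_v over the
    words v of one length m + 2 (counting_uniform). Then f(w) is the weight of w
    seen as a path in the graph with vertices the words of length m + 1 and edges
    the words v, of weight c_v. Running k times through a closed path multiplies
    its weight by k, so closed paths have weight 0 (weight_cycle). As the graph
    is strongly connected, c is the difference of a potential h
    (weight_potential):
      c_v = h(v without its last letter) - h(v without its first letter),
    and collecting the terms of each u of length m + 1 yields
      f = \sum_u h(u) (l_u - r_u).

    For the Brooks space, sigma is induced by f |-> antisym f, where
    antisym f (x) = f(x) - f(x^-1); hence K_Br consists of the counting functions
    f with antisym f bounded (KBrE). Write
      f = (f(x) + f(x^-1)) / 2 + antisym (antisym f) / 4.
    The first part is a combination of the s_w. In the second one, antisym f is a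
    combination of the l_w and r_w by the free group case, and inversion
    exchanges l_w and r_(w^-1), so that antisym l_w = se_w and
    antisym r_w = - se_(w^-1). *)

(** * Counting occurrences *)

Section Occurrences.
Variable A : finType.
Implicit Types (u v w x y : seq A) (s : A).

Lemma occ_empty v : occ v [::] = 0%N.
Proof. by apply: eq_card0 => -[]. Qed.

Lemma occ_cons v s w : occ v (s :: w) = (prefix v (s :: w) + occ v w)%N.
Proof.
rewrite /occ -!sum1_card [in LHS]big_mkcond [in RHS]big_mkcond big_ord_recl/=.
congr addn.
Qed.

Lemma occ_small v w : (size w < size v)%N -> occ v w = 0%N.
Proof.
elim: w => [|s w IHw] lt_w_v; first exact: occ_empty.
rewrite occ_cons IHw ?(ltn_trans _ lt_w_v)// addn0.
case: prefixP => // -[t wE].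
by move: lt_w_v; rewrite wE size_cat ltnNge leq_addr.
Qed.

Lemma occ_same_size v w : size v = size w -> v != [::] -> occ v w = (v == w).
Proof.
case: w => [|s w] eq_vw v0; first by rewrite -size_eq0 eq_vw in v0.
rewrite occ_cons occ_small ?eq_vw// addn0 prefixE take_oversize ?eq_vw//.
by rewrite eq_sym.
Qed.

(** A window of length |u| + 1 cannot start in x and end in y, and lies in one
    of x u and u y but not in both. *)
Lemma occ_overlap v x u y : size v = (size u).+1 ->
  occ v (x ++ u ++ y) = (occ v (x ++ u) + occ v (u ++ y))%N.
Proof.
move=> size_v; elim: x => [|s x IHx].
  by rewrite [X in (X + _)%N]occ_small ?size_v.
rewrite !cat_cons !occ_cons IHx addnA; congr (_ + _ + _)%N; rewrite !prefixE.
by rewrite size_v/= catA takel_cat// size_cat leq_addl.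
Qed.

Lemma occ_inadmissible (e : rel A) v w :
  sorted e w -> ~~ sorted e v -> occ v w = 0%N.
Proof.
elim: w => [|s w IHw] ew ev; first exact: occ_empty.
rewrite occ_cons IHw ?(path_sorted ew)// addn0.
case: (boolP (prefix v _)) => // /prefix_sorted/(_ ew).
by rewrite (negbTE ev).
Qed.

(** An occurrence of v extends to the left by exactly one letter, unless it is at
    the beginning of w. The term prefix v [::], which is 1 for v = [::] only,
    compensates for the empty word occurring size w times and not size w + 1
    times. *)
Lemma sum_occ_cons v w :
  (occ v w + prefix v [::] = prefix v w + \sum_(s : A) occ (s :: v) w)%N.
Proof.
elim: w => [|a w IHw].
  by rewrite occ_empty big1 ?addn0// => s _; rewrite occ_empty.
rewrite occ_cons -addnA IHw; congr addn.
under [in RHS]eq_bigr => s _ do rewrite occ_cons prefix_cons.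
rewrite big_split/=; congr addn.
by rewrite (bigD1 a)//= eqxx big1 ?addn0// => s /negbTE ->.
Qed.

Lemma sum_prefix_rcons v w :
  (\sum_(s : A) prefix (rcons v s) w = prefix v w && (w != v))%N.
Proof.
elim: v w => [|b v IHv] [|a w]; try by rewrite big1.
  under eq_bigr => s _ do rewrite prefix_cons prefix0s andbT.
  by rewrite (bigD1 a)//= eqxx big1// => s /negbTE ->.
under eq_bigr => s _ do rewrite rcons_cons prefix_cons.
rewrite prefix_cons eqseq_cons.
by have [_|_] := eqVneq b a; [rewrite IHv | rewrite big1].
Qed.

Lemma suffix_cons_eq v a w : suffix v (a :: w) = (v == a :: w) || suffix v w.
Proof.
apply/suffixP/orP => [[[|b x] H]|[/eqP->|/suffixP[x ->]]].
- by left; rewrite H.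
- by right; apply/suffixP; exists x; case: H.
- by exists [::].
- by exists (a :: x).
Qed.

(** An occurrence of v extends to the right by exactly one letter, unless it is
    at the end of w, which is not counted as an occurrence of [::]. *)
Lemma sum_occ_rcons v w :
  (occ v w = \sum_(s : A) occ (rcons v s) w + (suffix v w && (v != [::])))%N.
Proof.
elim: w => [|a w IHw].
  rewrite occ_empty big1 ?suffixs0 ?andbN// => s _; exact: occ_empty.
under eq_bigr => s _ do rewrite occ_cons.
rewrite big_split sum_prefix_rcons occ_cons IHw suffix_cons_eq.
rewrite addnCA [RHS]addnAC [RHS]addnC; congr addn.
have [->|_] := eqVneq v (a :: w); last by rewrite andbT.
rewrite -[X in prefix _ X]cats0 prefix_prefix/=.
by case: (boolP (suffix _ _)) => // /size_suffix; rewrite ltnn.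
Qed.

End Occurrences.

(** * Spans and bounded functions *)

Section Spans.
Variables (K : fieldType) (V : lmodType K).
Implicit Types (G H : set V) (f g : V).

Lemma lspanP G f : reflect (lspan G f) (f \in lspan_pred G).
Proof. exact: asboolP. Qed.

Lemma lspan_gen G f : G f -> f \in lspan_pred G.
Proof. by move=> Gf; apply/lspanP/lspan_incl. Qed.

Lemma lspan_ind (P : V -> Prop) G : P 0 ->
    (forall a f g, P f -> P g -> P (a *: f + g)) ->
  (forall g, G g -> P g) -> forall f, lspan G f -> P f.
Proof.
move=> P0 PD PG _ [m [c [g [Gg ->]]]].
elim/big_ind: _ => // [x y Px Py|i _]; first by rewrite -[x]scale1r; apply: PD.
by rewrite -[_ *: _]addr0; apply: PD => //; apply: PG.
Qed.

Lemma sub_lspan G H : G `<=` lspan H -> lspan G `<=` lspan H.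
Proof.
move=> GH; apply: lspan_ind => // [|a f g /lspanP fH /lspanP gH].
  by apply/lspanP; rewrite rpred0.
by apply/lspanP; rewrite rpredD ?rpredZ.
Qed.

Lemma eq_lspan G H : G `<=` lspan H -> H `<=` lspan G -> lspan G = lspan H.
Proof. by move=> GH HG; apply/seteqP; split; apply: sub_lspan. Qed.

End Spans.

Lemma bounded0 (K : numFieldType) (X : Type) : fequiv (0 : X -> K^o) 0.
Proof. by exists 0 => x; rewrite subrr normr0. Qed.

Lemma bounded_lin (K : numFieldType) (X : Type) (a : K) (f g : X -> K^o) :
  fequiv f 0 -> fequiv g 0 -> fequiv (a *: f + g) 0.
Proof.
move=> [M fM] [N gN]; exists (`|a| * M + N) => x.
have := fM x; have := gN x; rewrite !subr0 => gx fx.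
by rewrite (le_trans (ler_normD _ _))// lerD// normrM ler_wpM2l.
Qed.

(** * Extension relations *)

Section CountingFunctions.
Variables (K : numFieldType) (A : finType) (X : Type) (W : X -> seq A).

Definition cnt v : X -> K^o := fun x => (occ v (W x))%:R.
Definition lrel v := cnt v - \sum_(s : A) cnt (s :: v).
Definition rrel v := cnt v - \sum_(s : A) cnt (rcons v s).
Definition ext : set (X -> K^o) := range lrel `|` range rrel.

Lemma lrelE v x : lrel v x = (prefix v (W x))%:R - (prefix v [::])%:R.
Proof.
rewrite /lrel !fctE fct_sumE -natr_sum; apply/eqP.
rewrite subr_eq addrAC eq_sym subr_eq eq_sym -!natrD.
by rewrite sum_occ_cons.
Qed.

Lemma rrelE v x : rrel v x = (suffix v (W x) && (v != [::]))%:R.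
Proof.
rewrite /rrel !fctE fct_sumE -natr_sum {1}/cnt sum_occ_rcons.
by rewrite natrD addrC addKr.
Qed.

Lemma ext_bounded f : lspan ext f -> fequiv f 0.
Proof.
move: f; apply: (lspan_ind (P := fun f : X -> K^o => fequiv f 0)).
- exact: bounded0.
- exact: bounded_lin.
have leb (b : bool) : `|b%:R : K| <= 1 by case: b; rewrite ?normr1 ?normr0.
move=> _ [[v _ <-]|[v _ <-]]; [exists 2 | exists 1] => x; rewrite subr0.
  by rewrite lrelE (le_trans (ler_normB _ _))// (lerD (leb _) (leb _)).
by rewrite rrelE leb.
Qed.

Lemma ext_cnt : lspan ext `<=` lspan (range cnt).
Proof.
apply: sub_lspan => _ [[v _ <-]|[v _ <-]]; apply/lspanP.
  by rewrite rpredB ?rpred_sum// => *; apply: lspan_gen; exact: imageT.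
by rewrite rpredB ?rpred_sum// => *; apply: lspan_gen; exact: imageT.
Qed.

(** The relation r_v replaces p_v by the sum of the p_vs; repeating this lifts v
    to any length N. *)
Lemma cnt_uniform N v : (size v <= N)%N ->
  exists c : N.-tuple A -> K,
    lspan ext (cnt v - \sum_(u : N.-tuple A) c u *: cnt u).
Proof.
move=> /subnK; move: (N - size v)%N => d; elim: d v => [|d IHd] v sv.
  have vN : size v == N by rewrite -sv.
  exists (fun u => (u == Tuple vN)%:R); rewrite (bigD1 (Tuple vN))//=.
  rewrite eqxx scale1r big1 ?addr0 ?subrr; first exact/lspanP/rpred0.
  by move=> u /negbTE ->; rewrite scale0r.
have /choice[c cP] : forall s : A, exists c : N.-tuple A -> K,
    lspan ext (cnt (rcons v s) - \sum_(u : N.-tuple A) c u *: cnt u).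
  by move=> s; apply: IHd; rewrite size_rcons addnS.
exists (fun u => \sum_(s : A) c s u).
under eq_bigr => u _ do rewrite scaler_suml.
rewrite exchange_big/= -[cnt v](subrK (\sum_(s : A) cnt (rcons v s))).
rewrite -addrA -sumrB; apply/lspanP; rewrite rpredD ?rpred_sum//.
  by apply: lspan_gen; right; exact: imageT.
by move=> s _; apply/lspanP.
Qed.

(** All words of a counting function lift to a common length. The summand m keeps
    this length away from 0 and 1: the graph of the words of length N needs
    vertices, of length N - 1, that contain a letter. *)
Lemma counting_uniform m f : lspan (range cnt) f ->
  exists N (c : (m + N).-tuple A -> K),
    lspan ext (f - \sum_(u : (m + N).-tuple A) c u *: cnt u).
Proof.
move=> [k [a [g [gP ->]]]].
have /choice[v vP] : forall i, exists v, cnt v = g i.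
  by move=> i; have [v _ <-] := gP i; exists v.
pose N := (\max_(i < k) size (v i))%N; exists N.
have /choice[c cP] : forall i, exists c : (m + N).-tuple A -> K,
    lspan ext (cnt (v i) - \sum_(u : (m + N).-tuple A) c u *: cnt u).
  move=> i; apply: cnt_uniform; apply: leq_trans (leq_addl _ _).
  exact: (@leq_bigmax _ (fun i => size (v i))).
exists (fun u => \sum_(i < k) a i * c i u).
under [X in _ - X]eq_bigr => u _ do rewrite scaler_suml.
rewrite exchange_big/= -sumrB; apply/lspanP/rpred_sum => i _.
under eq_bigr => u _ do rewrite -scalerA.
by rewrite -scaler_sumr -scalerBr -vP rpredZ//; apply/lspanP.
Qed.

End CountingFunctions.

Arguments cnt K {A X} W v _.
Arguments lrel K {A X} W v _.
Arguments rrel K {A X} W v _.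
Arguments ext K {A X} W _.

(** * The potential of a bounded weight *)

Section Potential.
Variables (K : numFieldType) (A : finType) (e : rel A) (x0 : A) (m : nat).
Variable c : m.+2.-tuple A -> K.
Hypothesis e_conn : forall x y : A, exists z : A, e x z && e z y.
Hypothesis K_arch : forall a M : K, (forall k, `|a| *+ k <= M) -> a = 0.
Implicit Types (u v w x y z : seq A).

(** The counting function with coefficients c, as a function of words: the sum of
    c over the windows of length m + 2 of w. *)
Definition weight w : K := \sum_(u : m.+2.-tuple A) c u * (occ u w)%:R.

Hypothesis weight_bounded :
  exists M : K, forall w, sorted e w -> `|weight w| <= M.

Lemma weight_overlap x u y : size u = m.+1 ->
  weight (x ++ u ++ y) = weight (x ++ u) + weight (u ++ y).
Proof.
move=> su; rewrite /weight -big_split/=; apply: eq_bigr => v _.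
by rewrite occ_overlap ?size_tuple ?su// natrD mulrDr.
Qed.

Lemma weight_small w : (size w < m.+2)%N -> weight w = 0.
Proof.
move=> sw; rewrite /weight big1// => v _.
by rewrite occ_small ?size_tuple ?mulr0.
Qed.

Lemma weight_tuple (v : m.+2.-tuple A) : weight v = c v.
Proof.
rewrite /weight (bigD1 v)//= occ_same_size ?size_tuple -?size_eq0 ?size_tuple//.
rewrite eqxx mulr1 big1 ?addr0// => u u_v.
rewrite occ_same_size ?size_tuple -?size_eq0 ?size_tuple//.
by rewrite val_eqE (negbTE u_v) mulr0.
Qed.

Lemma sorted_overlap x u y : u != [::] -> sorted e (x ++ u) ->
  sorted e (u ++ y) -> sorted e (x ++ u ++ y).
Proof.
case: u => // a u _; case: x => [//|b x]; rewrite /= !cat_path/= !cat_path.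
by move=> /and3P[-> -> ->] /andP[_ ->].
Qed.

(** A closed path can be run through k times, which multiplies its weight by k;
    this is bounded only if the weight is 0. *)
Lemma weight_cycle u z : size u = m.+1 -> sorted e (u ++ z ++ u) ->
  weight (u ++ z ++ u) = 0.
Proof.
move=> su uzu; have [M MP] := weight_bounded.
have u0 : u != [::] by rewrite -size_eq0 su.
apply: (@K_arch _ M) => k.
suff [y uy Wy] : exists2 y, sorted e (u ++ y) &
    weight (u ++ y) = weight (u ++ z ++ u) *+ k.
  by rewrite -normrMn -Wy MP.
elim: k => [|k [y uy IHk]].
  exists [::]; first by rewrite cats0; case/cat_sorted2: uzu.
  by rewrite cats0 weight_small ?su.
exists (z ++ u ++ y); first by rewrite catA sorted_overlap// -catA.
by rewrite catA weight_overlap// IHk -catA mulrS.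
Qed.

(** A base vertex for the potential. *)
Lemma long_word k : exists2 w, size w = k & sorted e w.
Proof.
suff [w sw ew] : exists2 w, size w = k & path e x0 w.
  by exists w => //; exact: path_sorted ew.
elim: k x0 => [|k IHk] a; first by exists [::].
have [b /andP[ab _]] := e_conn a a.
by have [w sw bw] := IHk b; exists (b :: w); rewrite /= ?sw ?ab.
Qed.

(** The potential of u is the weight of a path from u to a base word u0. Given an
    edge v from u to u', close the path through u0, u and the one through
    u0, u, u' by the chosen paths back to u0. Both closed paths have weight 0,
    and the difference of their weights is c v + h u' - h u. *)
Lemma weight_potential : exists h : seq A -> K,
  forall v : m.+2.-tuple A, sorted e v -> c v = h (take m.+1 v) - h (behead v).
Proof.
have [k /(_ _ _)/andP kP] : exists k,
    forall x y : A, e x (k x y) && e (k x y) y.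
  have /choice[k kP] : forall xy : A * A, exists z : A, e xy.1 z && e z xy.2.
    by move=> xy; exact: e_conn.
  by exists (fun x y : A => k (x, y)) => x y; exact: kP (x, y).
pose join u w := k (last x0 u) (head x0 w) :: w.
have joinP u w : (0 < size u)%N -> (0 < size w)%N ->
    sorted e u -> sorted e w -> sorted e (u ++ join u w).
  case: u w => // a u [//|b w] _ _ /= eu ew.
  by rewrite cat_path eu/= ew; have [-> ->] := kP (last a u) b.
have [u0 su0 eu0] := long_word m.+1.
exists (fun w => weight (w ++ join w u0)) => v ev.
set u := take _ _; set u' := behead _.
have su : size u = m.+1 by rewrite size_takel ?size_tuple.
have su' : size u' = m.+1 by rewrite size_behead size_tuple.
have [t vE] : exists t, tval v = u ++ [:: t].
  have := cat_take_drop m.+1 v; have := size_drop m.+1 v.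
  rewrite size_tuple subSnn.
  by case: (drop _ _) => [//|t [|//]] _ <-; exists t.
have [s vE'] : exists s, tval v = s :: u'.
  by rewrite /u'; case: (tval v) (size_tuple v) => // s ? _; exists s.
have eu : sorted e u by move: ev; rewrite vE => /cat_sorted2[].
have eu' : sorted e u' by move: ev; rewrite vE' => /path_sorted.
have nil u1 : size u1 = m.+1 -> u1 != [::] by rewrite -size_eq0 => ->.
have pos u1 : size u1 = m.+1 -> (0 < size u1)%N by move=> ->.
(* a leads from u0 to u, while b and b' lead from u and u' back to u0 *)
pose a := u0 ++ join u0 u.
set b := u ++ join u u0; set b' := u' ++ join u' u0.
have eb : sorted e b by apply: joinP; rewrite ?pos.
have eb' : sorted e b' by apply: joinP; rewrite ?pos.
have ea : sorted e a by apply: joinP; rewrite ?pos.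
pose a0 := u0 ++ [:: k (last x0 u0) (head x0 u)].
have aE : a = a0 ++ u by rewrite /a0 -catA.
have Wu : weight a + weight b = 0.
  rewrite aE -weight_overlap//.
  pose z := k (last x0 u0) (head x0 u) :: u ++ [:: k (last x0 u) (head x0 u0)].
  have E : a0 ++ u ++ join u u0 = u0 ++ z ++ u0.
    by rewrite /a0 /z /join -!catA /= -!catA.
  by rewrite E weight_cycle// -E sorted_overlap ?nil// -aE.
have Wu' : weight a + c v + weight b' = 0.
  have av : weight a + c v = weight (a0 ++ [:: s] ++ u').
    by rewrite -weight_tuple aE -[[:: s] ++ u']vE' vE -weight_overlap.
  rewrite av catA -weight_overlap//.
  pose z := k (last x0 u0) (head x0 u) :: v
              ++ [:: k (last x0 u') (head x0 u0)].
  have E : (a0 ++ [:: s]) ++ u' ++ join u' u0 = u0 ++ z ++ u0.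
    by rewrite /a0 /z /join vE' -!catA /= -!catA.
  rewrite E weight_cycle// -E sorted_overlap ?nil//.
  by rewrite -catA [[:: s] ++ u']/= -vE' vE sorted_overlap ?nil// -?aE -?vE.
by apply/eqP; rewrite -subr_eq0 -(subrr 0) -{1}Wu' -Wu; apply/eqP; ring.
Qed.

End Potential.

(** * The bounded counting functions *)

Lemma big_tuple_cons (V : nmodType) (A : finType) k (F : seq A -> V) :
  \sum_(v : k.+1.-tuple A) F v = \sum_(u : k.-tuple A) \sum_(s : A) F (s :: u).
Proof.
rewrite pair_bigA/=.
rewrite (reindex (fun p : k.-tuple A * A => [tuple of p.2 :: p.1]))//=.
apply/onW_bij/inj_card_bij; last by rewrite card_prod !card_tuple expnSr.
by move=> [u s] [u' s'] /(congr1 val)[/= -> /val_inj ->].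
Qed.

Lemma big_tuple_rcons (V : nmodType) (A : finType) k (F : seq A -> V) :
  \sum_(v : k.+1.-tuple A) F v =
  \sum_(u : k.-tuple A) \sum_(s : A) F (rcons u s).
Proof.
rewrite pair_bigA/=.
rewrite (reindex (fun p : k.-tuple A * A => [tuple of rcons p.1 p.2]))//=.
apply/onW_bij/inj_card_bij; last by rewrite card_prod !card_tuple expnSr.
by move=> [u s] [u' s'] /(congr1 val) /= /rcons_inj[/val_inj -> ->].
Qed.

Section BoundedCounting.
Variables (K : numFieldType) (A : finType) (e : rel A) (x0 : A).
Variables (X : Type) (W : X -> seq A).
Hypothesis e_conn : forall x y : A, exists z : A, e x z && e z y.
Hypothesis K_arch : forall a M : K, (forall k, `|a| *+ k <= M) -> a = 0.
Hypothesis W_sorted : forall x, sorted e (W x).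
Hypothesis W_surj : forall w, sorted e w -> exists x, W x = w.

Lemma cnt_inadmissible v : ~~ sorted e v -> cnt K W v = 0.
Proof.
by move=> ev; apply/funext => x; rewrite /cnt (occ_inadmissible (W_sorted x)).
Qed.

(** The potential h of the coefficients turns the function into
    \sum_u h(u) (l_u - r_u): the word u starts the windows u s, and ends the
    windows s u. *)
Lemma uniform_bounded m (c : m.+2.-tuple A -> K) :
  fequiv (\sum_(v : m.+2.-tuple A) c v *: cnt K W v) 0 ->
  lspan (ext K W) (\sum_(v : m.+2.-tuple A) c v *: cnt K W v).
Proof.
move=> [M MP]; have [|h hP] := @weight_potential K A e x0 m c e_conn K_arch.
  exists M => w /W_surj[x <-]; have := MP x.
  by rewrite subr0 fct_sumE.
have -> : \sum_(v : m.+2.-tuple A) c v *: cnt K W v =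
    \sum_(u : m.+1.-tuple A) h u *: (lrel K W u - rrel K W u).
  transitivity (\sum_(v : m.+2.-tuple A)
      (h (take m.+1 v) *: cnt K W v - h (behead v) *: cnt K W v)).
    apply: eq_bigr => v _; rewrite -scalerBl.
    have [/hP ->//|/cnt_inadmissible ->] := boolP (sorted e v).
    by rewrite !scaler0.
  rewrite sumrB (big_tuple_rcons _ (fun v => h (take m.+1 v) *: cnt K W v)).
  rewrite (big_tuple_cons _ (fun v => h (behead v) *: cnt K W v)) -sumrB.
  apply: eq_bigr => u _; rewrite /lrel /rrel opprB [in RHS]addrC addrA subrK.
  rewrite scalerBr !scaler_sumr; congr (_ - _).
  apply: eq_bigr => s _; congr (h _ *: _).
  by rewrite -cats1 takel_cat ?take_oversize ?size_tuple.
apply/lspanP; rewrite rpred_sum// => u _; rewrite rpredZ// rpredB//.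
  by apply: lspan_gen; left; exact: imageT.
by apply: lspan_gen; right; exact: imageT.
Qed.

Theorem bounded_counting :
  [set f | lspan (range (cnt K W)) f /\ fequiv f 0] = lspan (ext K W).
Proof.
apply/seteqP; split => f; last first.
  by move=> fE; split; [exact: ext_cnt | exact: ext_bounded fE].
move=> [/(counting_uniform 2)[N [c fc]] f_bounded].
rewrite -[f](subrK (\sum_(u : (2 + N).-tuple A) c u *: cnt K W u)).
apply/lspanP; rewrite rpredD//; apply/lspanP => //.
apply: (uniform_bounded (m := N)).
set g := \sum_(_ | _) _ in fc *.
rewrite -[g](subKr f) addrC -scaleN1r; apply: bounded_lin => //.
exact: ext_bounded fc.
Qed.

End BoundedCounting.

(** * The scalars *)

Lemma archi_le0 (F : archiRealFieldType) (b N : F) :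
  (forall j, b *+ j <= N) -> b <= 0.
Proof.
move=> bN; rewrite leNgt; apply/negP => b0.
have N0 : 0 <= N by rewrite -(mulr0n b) bN.
have := archi_boundP (divr_ge0 N0 (ltW b0)).
by rewrite ltr_pdivrMr// ltNge mulr_natl bN.
Qed.

(** Over the complex numbers the order is partial, but |a| is real, and an
    inequality with M gives one with the real part of M. *)
Lemma scalars_archimedean (R : realType) (k : scalar_kind)
    (a M : scalars R k) : (forall j, `|a| *+ j <= M) -> a = 0.
Proof.
case: k a M => /= a M aM.
- by apply/eqP; rewrite -normr_le0 (archi_le0 aM).
- by apply/eqP; rewrite -normr_le0 (archi_le0 aM).
- apply/eqP; rewrite -normr_le0.
  suff : complex.Re `|a| <= 0 by rewrite normc_def /= -lecR.
  apply: (archi_le0 (N := complex.Re M)) => j.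
  by have := aM j; rewrite lecE => /andP[_]; rewrite raddfMn.
Qed.

(** * Free groups *)

Section FreeGroupSystem.
Variable n : nat.
Implicit Types (s : letter n) (v w : seq (letter n)).

Definition follows (x y : letter n) := y != linv x.

(** Either z = x will do, or y = x^-1 and any letter on another generator than x
    will; this is where two generators are needed. *)
Lemma follows_conn : (2 <= n)%N ->
  forall x y : letter n, exists z, follows x z && follows z y.
Proof.
move=> n2 x y; rewrite /follows.
have nx : x != linv x.
  by rewrite -pair_eqE /= /pair_eq/= negb_and; case: x.2; rewrite orbT.
have [yx|] := eqVneq y (linv x); last by exists x; rewrite nx.
have [i ix] : exists i, i != x.1.
  have : (0 < #|predC1 x.1|)%N by rewrite cardC1 card_ord -subn1 subn_gt0.
  by case/card_gt0P => i; exists i.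
exists (i, true).
rewrite yx (can_eq (@linvK n)); case: x ix {nx yx} => j b /= ix.
by rewrite /linv /= !xpair_eqE (eq_sym j) (negbTE ix).
Qed.

Lemma Fn_sorted (x : Fn n) : sorted follows x.
Proof. exact: fword_reduced. Qed.

Lemma Fn_surj w : sorted follows w -> exists x : Fn n, x = w :> seq _.
Proof. by move=> ew; exists (ReducedWord ew). Qed.

Lemma finv_wordK : involutive (@finv_word n).
Proof. by move=> x; apply/val_inj; rewrite /= winvK. Qed.

Variable K : numFieldType.
Local Notation cntF := (cnt K (@fword n)).
Local Notation lrelF := (lrel K (@fword n)).
Local Notation rrelF := (rrel K (@fword n)).

Lemma cntF_unreduced v : ~~ reduced v -> cntF v = 0.
Proof. exact: (cnt_inadmissible K Fn_sorted). Qed.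

(** The letters left out of the sum in l_w are those for which s w is not
    reduced. *)
Lemma lF_lrel w : lF K w = lrelF w.
Proof.
rewrite /lF /lrel; congr (_ - _); rewrite big_mkcond/=.
apply: eq_bigr => s _; case: w => [//|x w]; case: ifPn => // sx.
apply/esym/cntF_unreduced; apply: contra sx => /= /andP[+ _].
by apply: contra => /eqP ->; rewrite linvK.
Qed.

Lemma rF_rrel w : rF K w = rrelF w.
Proof.
rewrite /rF /rrel; congr (_ - _); rewrite big_mkcond/=.
apply: eq_bigr => s _; case: w => [//|x w]; case: ifPn => // sx.
apply/esym/cntF_unreduced; apply: contra sx.
by rewrite /reduced/= rcons_path => /andP[].
Qed.

Lemma relF_unreduced w : ~~ reduced w -> lrelF w = 0 /\ rrelF w = 0.
Proof.
move=> rw; rewrite /lrel /rrel cntF_unreduced// !sub0r.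
split; rewrite big1 ?oppr0// => s _; apply: cntF_unreduced.
  by apply: contra rw => /path_sorted.
by apply: contra rw; apply: prefix_sorted; exact: prefix_rcons.
Qed.

Lemma CF_cnt : CF K n = lspan (range cntF).
Proof.
apply: eq_lspan => _ [v _ <-]; apply/lspanP.
  by apply: lspan_gen; exists (fword v).
have [rv|/cntF_unreduced ->] := boolP (reduced v); last exact: rpred0.
by apply: lspan_gen; exists (ReducedWord rv).
Qed.

Lemma ext_FE : lspan (range (fun w : Fn n => lF K w) `|`
    range (fun w : Fn n => rF K w)) = lspan (ext K (@fword n)).
Proof.
apply: eq_lspan => _ [[w _ <-]|[w _ <-]]; apply/lspanP.
- by rewrite lF_lrel; apply: lspan_gen; left; exists (fword w).
- by rewrite rF_rrel; apply: lspan_gen; right; exists (fword w).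
- have [rw|/relF_unreduced[-> _]] := boolP (reduced w); last exact: rpred0.
  by apply: lspan_gen; left; exists (ReducedWord rw) => //; rewrite lF_lrel.
- have [rw|/relF_unreduced[_ ->]] := boolP (reduced w); last exact: rpred0.
  by apply: lspan_gen; right; exists (ReducedWord rw) => //; rewrite rF_rrel.
Qed.

Hypothesis n_ge2 : (2 <= n)%N.
Hypothesis K_arch : forall a M : K, (forall k, `|a| *+ k <= M) -> a = 0.

Theorem KF_ext : KF K n = lspan (ext K (@fword n)).
Proof.
rewrite /KF CF_cnt; pose x0 : letter n := (Ordinal (ltnW n_ge2), true).
exact: (bounded_counting x0 (follows_conn n_ge2) K_arch Fn_sorted Fn_surj).
Qed.

(** * Brooks quasimorphisms *)

(** Inversion turns the left extensions s w into the right extensions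
    w^-1 s^-1. *)
Lemma lrelF_inv w (x : Fn n) : lrelF w (finv_word x) = rrelF (winv w) x.
Proof.
rewrite /lrel /rrel !fctE !fct_sumE -[cntF w _]pF_winv; congr (_ - _).
rewrite (reindex_inj (can_inj (@linvK n))); apply: eq_bigr => s _.
rewrite -[LHS]pF_winv; congr pF.
by rewrite /winv/= rev_cons linvK.
Qed.

Lemma antisym_lrelF w : antisym (lrelF w) = lrelF w - rrelF (winv w).
Proof. by apply/funext => x; rewrite /antisym lrelF_inv. Qed.

Lemma antisym_rrelF w : antisym (rrelF w) = - (lrelF (winv w) - rrelF w).
Proof.
have rrelF_inv (x : Fn n) : rrelF w (finv_word x) = lrelF (winv w) x.
  by rewrite -{1}(winvK w) -lrelF_inv finv_wordK.
by apply/funext => x; rewrite /antisym rrelF_inv [in RHS]opprB.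
Qed.

Lemma antisym_lin a (f g : Fn n -> K^o) :
  antisym (a *: f + g) = a *: antisym f + antisym g.
Proof.
by apply/funext => x; rewrite /antisym !fctE scalerBr opprD addrACA.
Qed.

Lemma antisym0 : antisym (0 : Fn n -> K^o) = 0.
Proof. by apply/funext => x; rewrite /antisym subrr. Qed.

Lemma antisym_bounded (f : Fn n -> K^o) :
  fequiv f 0 -> fequiv (antisym f) 0.
Proof.
move=> [M fM]; exists (M + M) => x; rewrite subr0.
have := fM x; have := fM (finv_word x); rewrite !subr0 => ? ?.
by rewrite (le_trans (ler_normB _ _))// lerD.
Qed.

Lemma CF_antisym (f : Fn n -> K^o) : CF K n f -> CF K n (antisym f).
Proof.
move: f; apply: (lspan_ind (P := fun f : Fn n -> K^o => CF K n (antisym f))).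
- by rewrite antisym0; apply/lspanP/rpred0.
- move=> a f g /lspanP Cf /lspanP Cg; rewrite antisym_lin.
  by apply/lspanP; rewrite rpredD ?rpredZ.
move=> _ [v _ <-]; have -> : antisym (pF K v) = pF K v - pF K (finv_word v).
  by apply/funext => x; rewrite /antisym -pF_winv.
by apply/lspanP; rewrite rpredB//; apply: lspan_gen; exact: imageT.
Qed.

(** Both sides are linear and send p_v to the class of phi_v, and the p_v span. *)
Lemma sigmaE (f : CF_space K n) : sigma K n f = antisym_hat f.
Proof.
have [m [c [g [gP fE]]]] : lspan (@elementary K n) (val f).
  by apply/lspanP; exact: valP.
have /choice[v vP] : forall i, exists v : Fn n, pF K v = g i.
  by move=> i; have [v _ <-] := gP i; exists v.
have -> : f = \sum_(i < m) c i *: p_elt K (v i).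
  apply/val_inj; rewrite fE raddf_sum; apply: eq_bigr => i _.
  by rewrite -vP.
rewrite !linear_sum; apply: eq_bigr => i _; rewrite !linearZ/=; congr (_ *: _).
rewrite sigma_p; congr lquot_class; apply/val_inj/funext => x.
by rewrite /= /antisym/phi/= -pF_winv.
Qed.

Lemma KBrE : KBr K n = [set f | CF K n f /\ fequiv (antisym f) 0].
Proof.
have sigma0 (f : CF_space K n) :
    sigma K n f = 0 <-> fequiv (antisym (val f)) 0.
  rewrite sigmaE -(linear0 (lquot_class (Br_bounded_submod_closed K n))).
  by rewrite lquot_class_eq subr0; split => /asboolP.
apply/seteqP; split => [_ [f /sigma0 f0 <-]|f [Cf f0]].
  by split => //; apply/lspanP; exact: valP.
have Cf' : f \in lspan_pred (@elementary K n) by apply/lspanP.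
by exists (LSpan Cf') => //; apply/sigma0.
Qed.

(** The identity f = sym f / 2 + antisym (antisym f) / 4 splits f into a
    combination of the s_w and the image under antisym of a bounded function. *)
Theorem KBr_span : KBr K n = lspan (range (fun w : Fn n => sF K w) `|`
                                    range (fun w : Fn n => seF K w)).
Proof.
set G := _ `|` _; rewrite KBrE; apply/seteqP; split => f.
  move=> [Cf bf].
  pose sym (g : Fn n -> K^o) := fun x => g x + g (finv_word x).
  have sym_span : lspan G (sym f).
    move: f Cf {bf}; apply: (lspan_ind (P := fun f => lspan G (sym f))).
    - rewrite [sym _](_ : _ = 0); first exact/lspanP/rpred0.
      by apply/funext => x; rewrite /sym addr0.
    - move=> a f g /lspanP Gf /lspanP Gg.
      rewrite [sym _](_ : _ = a *: sym f + sym g).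
        by apply/lspanP; rewrite rpredD ?rpredZ.
      by apply/funext => x; rewrite /sym !fctE scalerDr addrACA.
    move=> _ [v _ <-]; apply: lspan_incl; left; exists v => //.
    by apply/funext => x; rewrite /sym -pF_winv.
  have antisym_span : lspan G (antisym (antisym f)).
    have : KF K n (antisym f) by split; [exact: CF_antisym|].
    rewrite KF_ext -ext_FE; move: (antisym f).
    apply: (lspan_ind (P := fun f => lspan G (antisym f))).
    - by rewrite antisym0; apply/lspanP/rpred0.
    - move=> a g h /lspanP Gg /lspanP Gh; rewrite antisym_lin.
      by apply/lspanP; rewrite rpredD ?rpredZ.
    move=> _ [[w _ <-]|[w _ <-]].
      apply: lspan_incl; right; exists w => //.
      by rewrite lF_lrel antisym_lrelF /seF lF_lrel rF_rrel.
    apply/lspanP; rewrite rF_rrel antisym_rrelF rpredN.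
    apply: lspan_gen; right; exists (finv_word w) => //.
    by rewrite /seF lF_lrel rF_rrel /= winvK.
  (* antisym is twice the identity on its image *)
  have -> : f = 2^-1 *: (sym f + 2^-1 *: antisym (antisym f)).
    apply/funext => x; rewrite !fctE /sym /antisym finv_wordK /GRing.scale/=.
    by field.
  by apply/lspanP; rewrite rpredZ// rpredD ?rpredZ//; apply/lspanP.
move: f; apply: (lspan_ind (P := fun f => CF K n f /\ fequiv (antisym f) 0)).
- by split; [apply/lspanP/rpred0|rewrite antisym0; exact: bounded0].
- move=> a f g [/lspanP Cf bf] [/lspanP Cg bg]; split.
    by apply/lspanP; rewrite rpredD ?rpredZ.
  by rewrite antisym_lin; exact: bounded_lin.
move=> _ [[w _ <-]|[w _ <-]].
  split; last first.
    have -> : antisym (sF K w) = 0; last exact: bounded0.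
    apply/funext => x; rewrite /antisym /sF !fctE !pF_winv finv_wordK.
    by rewrite [X in _ - X]addrC subrr.
  by apply/lspanP; rewrite rpredD//; apply: lspan_gen;
    [exists w | exists (finv_word w)].
have [Cw bw] : KF K n (seF K w).
  rewrite KF_ext /seF lF_lrel rF_rrel; apply/lspanP; rewrite rpredB//.
    by apply: lspan_gen; left; exact: imageT.
  by apply: lspan_gen; right; exact: imageT.
by split => //; exact: antisym_bounded.
Qed.

End FreeGroupSystem.

(** * The three kernels *)

Theorem theorem1p4 (R : realType) (k : scalar_kind) (n : nat)
    (n_ge2 : (2 <= n)%N) :
  [/\ KM (scalars R k) n =
        lspan (range (fun w : seq 'I_n => lM (scalars R k) w) `|`
               range (fun w : seq 'I_n => rM (scalars R k) w)),
      KF (scalars R k) n =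
        lspan (range (fun w : Fn n => lF (scalars R k) w) `|`
               range (fun w : Fn n => rF (scalars R k) w))
    & KBr (scalars R k) n =
        lspan (range (fun w : Fn n => sF (scalars R k) w) `|`
               range (fun w : Fn n => seF (scalars R k) w))].
Proof.
have K_arch := @scalars_archimedean R k.
split; last 1 first.
- exact: KBr_span.
- pose i0 : 'I_n := Ordinal (ltnW n_ge2).
  have e_conn (x y : 'I_n) : exists z : 'I_n, true && true by exists x.
  apply: (bounded_counting (e := fun _ _ => true) (W := id) i0 e_conn K_arch).
  + by case=> // a w; elim: w a => //=.
  + by move=> w; exists w.
- by rewrite ext_FE; exact: KF_ext.
Qed.
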